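(* Let $\mathbb{F}$ be a field and let $\mathcal{E}$ be an evolution algebra over $\mathbb{F}$ with natural basis $B=\{e_1,\ldots,e_n\}$ and such that $\mathrm{ann}(\mathcal{E})=0$. Then $\mathcal{E}$ is indecomposable if and only if the graph $\Gamma(\mathcal{E},B)$ is connected.
   Context: An algebra over a field $\mathbb{F}$ (arbitrary) is a finite-dimensional $\mathbb{F}$-vector space with a bilinear multiplication (not necessarily associative or unital). An evolution algebra is an algebra $\mathcal{E}$ with a vector space basis $B=\{e_1,\ldots,e_n\}$ such that $e_ie_j=0=e_je_i$ for all $i\neq j$ (so $\mathcal{E}$ is commutative); such a basis is called a natural basis. Writing $e_i^2=\sum_{j=1}^n\alpha_{ij}e_j$ with $\alpha_{ij}\in\mathbb{F}$, the graph $\Gamma(\mathcal{E},B)$ is the directed graph with vertex set $V=\{1,\ldots,n\}$ and edge set $E=\{(i,j)\in V\times V:\alpha_{ij}\neq 0\}$. A directed graph is connected if its vertex set is not a disjoint union of two nonempty subsets $I,J$ such that there is no edge (in either direction) between an element of $I$ and an element of $J$. The annihilator is $\mathrm{ann}(\mathcal{E})=\{x\in\mathcal{E}: x\mathcal{E}=0\}$. An ideal of $\mathcal{E}$ is a subspace $\mathcal{I}$ with $\mathcal{E}\mathcal{I}\subseteq\mathcal{I}$ (no other condition is imposed). $\mathcal{E}$ is decomposable if there are nonzero ideals $\mathcal{I},\mathcal{J}$ with $\mathcal{E}=\mathcal{I}\oplus\mathcal{J}$; otherwise it is indecomposable. *)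

(* Defs.v *)
From mathcomp Require Import all_boot all_order all_algebra.

Set Implicit Arguments.
Unset Strict Implicit.
Unset Printing Implicit Defensive.

Import GRing.Theory.
Local Open Scope ring_scope.

Section EvolutionAlgebra.

Variables (F : fieldType) (E : vectType F) (mul : {bilinear E -> E -> E}).

Definition natural_basis (n : nat) (B : n.-tuple E) : Prop :=
  basis_of fullv B /\
  forall i j : 'I_n, i != j -> mul (tnth B i) (tnth B j) = 0.

Definition structure_constant (n : nat) (B : n.-tuple E) (i j : 'I_n) : F :=
  coord B j (mul (tnth B i) (tnth B i)).

Definition evolution_graph (n : nat) (B : n.-tuple E) : rel 'I_n :=
  fun i j => structure_constant B i j != 0.

Definition annihilator (x : E) : Prop := forall y : E, mul x y = 0.

(* Left and right ideals coincide here: an algebra with a natural basis is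
   commutative. *)
Definition is_ideal (I : {vspace E}) : Prop :=
  forall x y : E, y \in I -> mul x y \in I.

Definition decomposable : Prop :=
  exists I J : {vspace E},
    [/\ is_ideal I, is_ideal J, I != 0%VS, J != 0%VS
      & (I + J)%VS = fullv /\ directv (I + J)].

Definition indecomposable : Prop := ~ decomposable.

End EvolutionAlgebra.

(* Weak connectedness; the empty graph counts as connected. *)
Definition digraph_connected (V : finType) (e : rel V) : Prop :=
  ~ exists I J : {set V},
      [/\ I != set0, J != set0, I :|: J = [set: V], [disjoint I & J]
        & forall i j : V, i \in I -> j \in J -> ~~ e i j /\ ~~ e j i].

(* Main.v *)
(* If E = I (+) J with I and J ideals, then I J is contained in I :&: J = 0.
   Write e_i = u + v with u in I and v in J.  For k != i,
   u e_k + v e_k = e_i e_k = 0, so u e_k lies in I :&: J = 0; since u e_k is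
   u_k e_k^2 and e_k^2 != 0 (the annihilator is trivial), u_k = v_k = 0.  Thus
   u and v are multiples of e_i, and u v = 0 forces one of them to vanish: every
   e_i lies in I or in J, and this splits the graph.  Conversely, a splitting of
   the vertices spans two complementary ideals. *)

Require Import Defs.
From mathcomp Require Import all_boot all_order all_algebra.

Set Implicit Arguments.
Unset Strict Implicit.
Unset Printing Implicit Defensive.

Import GRing.Theory.
Local Open Scope ring_scope.

Section NaturalBasis.

Variables (F : fieldType) (E : vectType F) (mul : {bilinear E -> E -> E}).
Variables (n : nat) (B : n.-tuple E).
Hypothesis natB : natural_basis mul B.

Lemma coord_natural_basis (x : E) : x = \sum_i coord B i x *: tnth B i.
Proof.
rewrite [LHS](coord_basis natB.1 (memvf x)).
by apply: eq_bigr => i _; rewrite -tnth_nth.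
Qed.

Lemma coord_tnth (i j : 'I_n) : coord B j (tnth B i) = (i == j)%:R.
Proof.
by rewrite (tnth_nth 0) coord_free ?(basis_free natB.1) // eq_sym.
Qed.

Lemma tnth_neq0 (i : 'I_n) : tnth B i != 0.
Proof.
apply/eqP => Bi0; have /eqP := coord_tnth i i.
by rewrite Bi0 linear0 eqxx eq_sym oner_eq0.
Qed.

(** Against e_k only the k-th term of the expansion of [x] survives. The later product computations
    rest on this. *)
Lemma mul_tnth (x : E) (k : 'I_n) :
  mul x (tnth B k) = coord B k x *: mul (tnth B k) (tnth B k).
Proof.
rewrite {1}(coord_natural_basis x) linear_sumlz (bigD1 k) //= linearZl_LR /=.
rewrite big1 ?addr0 // => i neq_ik.
by rewrite linearZl_LR /= natB.2 // scaler0.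
Qed.

Lemma mul_coordE (x y : E) :
  mul x y = \sum_k (coord B k x * coord B k y) *: mul (tnth B k) (tnth B k).
Proof.
rewrite {1}(coord_natural_basis y) linear_sumr; apply: eq_bigr => k _.
by rewrite linearZr_LR /= mul_tnth scalerA mulrC.
Qed.

Lemma natural_basis_mulC (x y : E) : mul x y = mul y x.
Proof. by rewrite !mul_coordE; apply: eq_bigr => k _; rewrite mulrC. Qed.

Definition coord_span (S : {set 'I_n}) : {vspace E} :=
  (\sum_(i in S) <[tnth B i]>)%VS.

Lemma coord_spanP (S : {set 'I_n}) (x : E) :
  reflect (forall j, j \notin S -> coord B j x = 0) (x \in coord_span S).
Proof.
apply: (iffP idP) => [/memv_sumP[v Sv ->] j jS | x0].
  rewrite linear_sum big1 // => i iS; have /vlineP[c ->] := Sv i iS.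
  rewrite linearZ /= coord_tnth; case: eqP => [eq_ij|_]; last by rewrite mulr0.
  by rewrite -eq_ij iS in jS.
rewrite [x]coord_natural_basis (bigID (mem S)) /= [X in _ + X]big1 ?addr0.
  by apply: memv_sumr => i iS; rewrite memvZ ?memv_line.
by move=> i /x0->; rewrite scale0r.
Qed.

Lemma coord_span_neq0 (S : {set 'I_n}) : S != set0 -> coord_span S != 0%VS.
Proof.
case/set0Pn => i iS; apply/eqP => S0.
have: tnth B i \in coord_span S.
  apply/coord_spanP => j jS; rewrite coord_tnth; case: eqP => // eq_ij.
  by rewrite -eq_ij iS in jS.
by rewrite S0 memv0 (negPf (tnth_neq0 i)).
Qed.

(** A product with [y] in the span is a combination of the squares e_i^2 with i in [S]; as no edge
    leaves [S], these squares stay in the span. *)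
Lemma coord_span_ideal (S : {set 'I_n}) :
  (forall i j, i \in S -> j \notin S -> ~~ evolution_graph mul B i j) ->
  is_ideal mul (coord_span S).
Proof.
move=> closedS x y /coord_spanP yS; apply/coord_spanP => j jS.
rewrite mul_coordE linear_sum big1 // => i _; rewrite linearZ /=.
have [iS|/yS->] := boolP (i \in S); last by rewrite mulr0 mul0r.
have := closedS i j iS jS; rewrite negbK => /eqP.
by rewrite /structure_constant => ->; rewrite mulr0.
Qed.

Lemma coord_span_addC (S : {set 'I_n}) :
  (coord_span S + coord_span (~: S))%VS = fullv.
Proof.
apply/vspaceP => x; rewrite memvf [x]coord_natural_basis (bigID (mem S)) /=.
apply: memv_add; first by apply: memv_sumr => i _; rewrite memvZ ?memv_line.
under eq_bigl => i do rewrite -in_setC.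
by apply: memv_sumr => i _; rewrite memvZ ?memv_line.
Qed.

Lemma coord_span_capC (S : {set 'I_n}) :
  (coord_span S :&: coord_span (~: S))%VS = 0%VS.
Proof.
apply/eqP; rewrite -subv0; apply/subvP => x.
rewrite memv_cap => /andP[/coord_spanP xS /coord_spanP xSC].
rewrite memv0 [x]coord_natural_basis big1 // => i _.
have [iS|/xS->] := boolP (i \in S); last by rewrite scale0r.
by rewrite xSC ?scale0r // in_setC iS.
Qed.

(** Excluding edges out of [S] makes the span of [S] an ideal; excluding edges into [S] does the
    same for the complement. *)
Lemma decomposable_coord_span (S : {set 'I_n}) :
    S != set0 -> ~: S != set0 ->
    (forall i j, i \in S -> j \notin S ->
       ~~ evolution_graph mul B i j /\ ~~ evolution_graph mul B j i) ->
  decomposable mul.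
Proof.
move=> S0 SC0 noedge; exists (coord_span S), (coord_span (~: S)); split.
- by apply: coord_span_ideal => i j iS jS; case: (noedge i j iS jS).
- apply: coord_span_ideal => i j; rewrite !in_setC negbK => iS jS.
  by case: (noedge j i jS iS).
- exact: coord_span_neq0.
- exact: coord_span_neq0.
- split; first exact: coord_span_addC.
  exact/directv_addP/coord_span_capC.
Qed.

Lemma basis_sub_fullv (U : {vspace E}) :
  (forall i, tnth B i \in U) -> U = fullv.
Proof.
move=> BU; apply/vspaceP => x; rewrite memvf [x]coord_natural_basis.
by apply: memv_suml => i _; apply: memvZ.
Qed.

Hypothesis ann0 : forall x : E, annihilator mul x <-> x = 0.

(** Every product e_i y is a multiple of e_i^2, so e_i^2 = 0 would put the nonzero vector e_i in the
    annihilator. *)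
Lemma sqr_tnth_neq0 (i : 'I_n) : mul (tnth B i) (tnth B i) != 0.
Proof.
apply/eqP => sqr0; have /eqP[] := tnth_neq0 i; apply/ann0 => y.
by rewrite natural_basis_mulC mul_tnth sqr0 scaler0.
Qed.

Section IdealDecomposition.

Variables I J : {vspace E}.
Hypotheses (idI : is_ideal mul I) (idJ : is_ideal mul J).
Hypotheses (addIJ : (I + J)%VS = fullv) (capIJ : (I :&: J)%VS = 0%VS).

Lemma mem_ideals_eq0 (x : E) : x \in I -> x \in J -> x = 0.
Proof. by move=> xI xJ; apply/eqP; rewrite -memv0 -capIJ memv_cap xI. Qed.

Lemma mul_ideals_eq0 (x y : E) : x \in I -> y \in J -> mul x y = 0.
Proof.
move=> xI yJ; apply: mem_ideals_eq0; last exact: idJ.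
by rewrite natural_basis_mulC; apply: idI.
Qed.

Lemma tnth_mem_ideals (i : 'I_n) : (tnth B i \in I) || (tnth B i \in J).
Proof.
have: tnth B i \in (I + J)%VS by rewrite addIJ memvf.
case/memv_addP=> u uI [v vJ Di].
have u_k k : k != i -> coord B k u = 0.
  move=> neq_ki; have uBk := mul_tnth u k.
  have: mul u (tnth B k) = 0.
    apply: mem_ideals_eq0; first by rewrite natural_basis_mulC; apply: idI.
    (* Since e_i e_k = 0, u e_k = - v e_k, which lies in [J]. *)
    have := natB.2 _ _ neq_ki; rewrite natural_basis_mulC Di linearDl /=.
    move/eqP; rewrite addr_eq0 => /eqP->.
    by rewrite memvN natural_basis_mulC; apply: idJ.
  rewrite uBk => /eqP.
  by rewrite scaler_eq0 (negPf (sqr_tnth_neq0 k)) orbF => /eqP.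
have Du : u = coord B i u *: tnth B i.
  rewrite {1}[u]coord_natural_basis (bigD1 i) //= big1 ?addr0 // => k /u_k->.
  by rewrite scale0r.
(* With u = c e_i: if c = 0, then e_i = v lies in [J]; otherwise e_i = c^-1 u lies in [I]. *)
have [u0|u_neq0] := eqVneq (coord B i u) 0.
  by rewrite {2}Di Du u0 scale0r add0r vJ orbT.
by rewrite -(scalerK u_neq0 (tnth B i)) -Du memvZ.
Qed.

(** As e_i^2 is in [I] and e_j in [J], their product vanishes; it equals the structure constant of
    (i, j) times e_j^2, and e_j^2 is nonzero. *)
Lemma ideals_no_edge (i j : 'I_n) :
  tnth B i \in I -> tnth B j \in J -> ~~ evolution_graph mul B i j.
Proof.
move=> iI jJ; rewrite negbK; have := mul_ideals_eq0 (idI (tnth B i) iI) jJ.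
by rewrite mul_tnth => /eqP; rewrite scaler_eq0 (negPf (sqr_tnth_neq0 j)) orbF.
Qed.

(** If [I] contained the whole basis, [J] would equal its intersection with [I], which is zero. *)
Lemma exists_tnth_notin : J != 0%VS -> exists i, tnth B i \notin I.
Proof.
move=> J0; apply/existsP; rewrite -negb_forall; apply: contra J0.
by move/forallP/basis_sub_fullv=> If; rewrite -capIJ If capfv.
Qed.

End IdealDecomposition.

End NaturalBasis.

Theorem proposition2p8 (F : fieldType) (E : vectType F)
    (mul : {bilinear E -> E -> E}) (n : nat) (B : n.-tuple E)
    (hB : natural_basis mul B)
    (hann : forall x : E, annihilator mul x <-> x = 0) :
  indecomposable mul <-> digraph_connected (evolution_graph mul B).
Proof.
split=> [indec [S [T [S0 T0 ST dST noedge]]] | conn [I [J]]].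
  have TE : ~: S = T.
    apply/setP => i; rewrite in_setC; have := in_setT i; rewrite -ST in_setU.
    by have [iS _|] //= := boolP (i \in S); rewrite (disjointFr dST iS).
  apply: indec; apply: (decomposable_coord_span hB S0); rewrite ?TE //.
  by move=> i j iS jS; apply: noedge; rewrite // -TE in_setC.
case=> idI idJ I0 J0 [addIJ /directv_addP capIJ].
(* The swapped identities let the lemmas on a pair of ideals be applied with [I] and [J]
   exchanged. *)
have addJI : (J + I)%VS = fullv by rewrite addvC.
have capJI : (J :&: I)%VS = 0%VS by rewrite capvC.
have BIJ := tnth_mem_ideals hB hann idI idJ addIJ capIJ.
apply: conn; exists [set i | tnth B i \in I], [set i | tnth B i \in J]; split.
(* A basis vector outside [J] must lie in [I]. *)
- have [i iJ] := exists_tnth_notin hB capJI I0.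
  by apply/set0Pn; exists i; rewrite inE; have := BIJ i; rewrite (negPf iJ) orbF.
- have [i iI] := exists_tnth_notin hB capIJ J0.
  by apply/set0Pn; exists i; rewrite inE; have := BIJ i; rewrite (negPf iI).
- by apply/setP => i; rewrite !inE BIJ.
- rewrite -setI_eq0; apply/eqP/setP => i; rewrite !inE; apply/andP => -[iI iJ].
  by have /eqP := mem_ideals_eq0 capIJ iI iJ; rewrite (negPf (tnth_neq0 hB i)).
- move=> i j; rewrite !inE => iI jJ; split.
    exact: (ideals_no_edge hB hann idI idJ capIJ).
  exact: (ideals_no_edge hB hann idJ idI capJI).
Qed.
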